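(* Let $\zeta=\zeta_1+\zeta_2$ be a $2$-Killing vector field on the doubly warped product manifold ${}_{f_2}M_1\times_{f_1}M_2$, where each $\zeta_i$ is the lift of a vector field on $M_i$ (denoted in the same way). Let $r_i$ be the scalar curvature of $(M_i,g_i)$, $i\in\{1,2\}$. Then $(M_1,g_1,\zeta_1)$ is a hyperbolic Yamabe soliton, with constants $\lambda,\mu\in\mathbb R$ satisfying $\lambda f_2^2\neq 2\zeta_2(f_2^2)$ at every point, if and only if there exist $\lambda,\mu\in\mathbb R$ with $\lambda f_2^2\neq 2\zeta_2(f_2^2)$ at every point such that $$\pounds_{\zeta_1}g_1=\frac{(\mu-r_1)f_2^2+\zeta_2(\zeta_2(f_2^2))}{\lambda f_2^2-2\zeta_2(f_2^2)}g_1.$$ Similarly, $(M_2,g_2,\zeta_2)$ is a hyperbolic Yamabe soliton, with constants $\lambda,\mu\in\mathbb R$ satisfying $\lambda f_1^2\neq 2\zeta_1(f_1^2)$ at every point, if and only if there exist $\lambda,\mu\in\mathbb R$ with $\lambda f_1^2\neq 2\zeta_1(f_1^2)$ at every point such that $$\pounds_{\zeta_2}g_2=\frac{(\mu-r_2)f_1^2+\zeta_1(\zeta_1(f_1^2))}{\lambda f_1^2-2\zeta_1(f_1^2)}g_2.$$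
   Context: Let $(M_i,g_i)$, $i\in\{1,2\}$, be Riemannian manifolds, $M:=M_1\times M_2$, with canonical projections $\pi_i:M\to M_i$. The doubly warped product manifold ${}_{f_2}M_1\times_{f_1}M_2$ is $(M,\bar g)$ with $$\bar g=(\pi_2^*(f_2))^2\pi_1^*(g_1)+(\pi_1^*(f_1))^2\pi_2^*(g_2),$$ where $f_1:M_1\to(0,\infty)$ and $f_2:M_2\to(0,\infty)$ are smooth functions. The same notation is used for functions and metrics on factor manifolds and for their pullbacks to the product; identities mixing objects from different factors are understood on the product. A vector field $\zeta$ on $(M,\bar g)$ is $2$-Killing if $\pounds_{\zeta}\pounds_{\zeta}\bar g:=\pounds_{\zeta}(\pounds_{\zeta}\bar g)=0$, where $\pounds$ is the Lie derivative. A triple $(N,h,\xi)$, with $(N,h)$ a Riemannian manifold and $\xi$ a smooth vector field on $N$, is a hyperbolic Yamabe soliton with constants $\lambda,\mu\in\mathbb R$ if $\pounds_{\xi}\pounds_{\xi}h+\lambda\pounds_{\xi}h=(\mu-r)h$, where $r$ is the scalar curvature of $(N,h)$. *)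

(* Defs.v *)
From HB Require Import structures.
From mathcomp Require Import all_boot all_order all_algebra.
From mathcomp Require Import all_classical all_reals all_analysis.

Set Implicit Arguments.
Unset Strict Implicit.
Unset Printing Implicit Defensive.

Import Order.TTheory GRing.Theory Num.Theory.
Import numFieldNormedType.Exports.

Local Open Scope classical_set_scope.
Local Open Scope ring_scope.

(* C^k on an open set U of R^n.  Membership of U is only tested at the point
   of differentiation; for open U the derivatives below depend only on the
   restriction of f to U. *)
Section smooth_on.
Context {R : realType} {n : nat}.

Fixpoint class_C (k : nat) (U : set 'rV[R]_n) (f : 'rV[R]_n -> R) : Prop :=
  if k is k'.+1 then
    (forall x, U x -> differentiable f x) /\
    (forall i : 'I_n, class_C k' U ('D_(delta_mx 0 i) f))
  else forall x, U x -> {for x, continuous f}.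

Definition smooth_on (U : set 'rV[R]_n) (f : 'rV[R]_n -> R) : Prop :=
  forall k, class_C k U f.

End smooth_on.

(* An n-dimensional smooth manifold, given by a smooth atlas (not required to
   be maximal: all notions below extend uniquely to compatible charts).
   [chart] is the index type of the atlas; [coord c] is the coordinate map of
   c, meaningful on [dom c], and [param c] is its inverse. *)
Record manifold (R : realType) (n : nat) := Manifold {
  carrier :> topologicalType;
  chart : Type;
  dom : chart -> set carrier;
  coord : chart -> carrier -> 'rV[R]_n;
  param : chart -> 'rV[R]_n -> carrier;
  manifold_nonempty : [set: carrier] !=set0;
  manifold_hausdorff : hausdorff_space carrier;
  manifold_second_countable : @second_countable carrier;
  chart_cover : forall p, exists c, dom c p;
  dom_open : forall c, open (dom c);
  coord_open : forall c, open (coord c @` dom c);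
  coordK : forall c p, dom c p -> param c (coord c p) = p;
  coord_continuous : forall c p, dom c p -> {for p, continuous (coord c)};
  param_continuous : forall c p, dom c p ->
    {for coord c p, continuous (param c)};
  transition_smooth : forall c d k,
    smooth_on (coord c @` (dom c `&` dom d)) (fun x => coord d (param c x) 0 k)
}.

Arguments dom {R n M} : rename.
Arguments coord {R n M} : rename.
Arguments param {R n M} : rename.

Section manifold_theory.
Context {R : realType} {n : nat} {M : manifold R n}.
Implicit Types (c d : chart M) (p : M) (F : M -> R).

Definition chart_at p : chart M := projT1 (cid (chart_cover p)).

Lemma chart_atP p : dom (chart_at p) p.
Proof. exact: projT2 (cid (chart_cover p)). Qed.

Definition smooth_in c F : Prop := smooth_on (coord c @` dom c) (F \o param c).

Definition smooth_fun F : Prop := forall c, smooth_in c F.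

Definition pd c (i : 'I_n) F p : R :=
  'D_(delta_mx 0 i) (F \o param c) (coord c p).

(* entry (i, k) is dy^k/dx^i, for x the coordinates of c and y those of d *)
Definition jac c d p : 'M[R]_n :=
  \matrix_(i, k) pd c i (fun q => coord d q 0 k) p.

(* A vector field is given by its row of components in each chart; the
   components obey dy^k = sum_i (dy^k/dx^i) dx^i. *)
Record vector_field := VectorField {
  vf_comp :> chart M -> M -> 'rV[R]_n;
  vf_smooth : forall c k, smooth_in c (fun p => vf_comp c p 0 k);
  vf_law : forall c d p, dom c p -> dom d p ->
    vf_comp d p = vf_comp c p *m jac c d p
}.

(* components T_ij of a field of bilinear forms in each chart; values outside
   the domain of the chart are irrelevant *)
Local Notation tensor2 := (chart M -> M -> 'M[R]_n).

Record riemannian_metric := RiemannianMetric {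
  metric_comp :> tensor2;
  metric_smooth : forall c i j, smooth_in c (fun p => metric_comp c p i j);
  metric_law : forall c d p, dom c p -> dom d p ->
    metric_comp c p = jac c d p *m metric_comp d p *m (jac c d p)^T;
  metric_sym : forall c p, dom c p -> (metric_comp c p)^T = metric_comp c p;
  metric_pos : forall c p, dom c p -> forall v : 'rV[R]_n, v != 0 ->
    0 < (v *m metric_comp c p *m v^T) 0 0
}.

(* X(F), computed in a chart around the point; the value does not depend on
   this chart, by vf_law and the chain rule. *)
Definition vf_act (X : vector_field) F : M -> R := fun p =>
  \sum_(k < n) X (chart_at p) p 0 k * pd (chart_at p) k F p.

(* (L_X T)_ij = X^k d_k T_ij + T_kj d_i X^k + T_ik d_j X^k *)
Definition lie (X : vector_field) (T : tensor2) : tensor2 := fun c p =>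
  \matrix_(i, j) \sum_(k < n)
    (X c p 0 k * pd c k (fun q => T c q i j) p
     + T c p k j * pd c i (fun q => X c q 0 k) p
     + T c p i k * pd c j (fun q => X c q 0 k) p).

(* Gamma^k_ij = 1/2 g^kl (d_i g_jl + d_j g_il - d_l g_ij) *)
Definition christoffel (g : tensor2) c (k i j : 'I_n) p : R :=
  2^-1 * \sum_(l < n) invmx (g c p) k l *
    (pd c i (fun q => g c q j l) p + pd c j (fun q => g c q i l) p
     - pd c l (fun q => g c q i j) p).

(* Ric_jk = d_i Gamma^i_jk - d_j Gamma^i_ik
            + Gamma^i_im Gamma^m_jk - Gamma^i_jm Gamma^m_ik *)
Definition ricci (g : tensor2) c (j k : 'I_n) p : R :=
  \sum_(i < n)
    (pd c i (christoffel g c i j k) p - pd c j (christoffel g c i i k) p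
     + \sum_(m < n) (christoffel g c i i m p * christoffel g c m j k p
                     - christoffel g c i j m p * christoffel g c m i k p)).

(* The trace g^jk Ric_jk, computed in a chart around the point; the value does
   not depend on this chart, by metric_law. *)
Definition scalar_curvature (g : tensor2) : M -> R := fun p =>
  \sum_(j < n) \sum_(k < n)
    invmx (g (chart_at p) p) j k * ricci g (chart_at p) j k p.

Definition two_killing (g : riemannian_metric) (X : vector_field) : Prop :=
  forall c p, dom c p -> lie X (lie X g) c p = 0.

Definition hyperbolic_yamabe_soliton
    (g : riemannian_metric) (X : vector_field) (lambda mu : R) : Prop :=
  forall c p, dom c p ->
    lie X (lie X g) c p + lambda *: lie X g c p
    = (mu - scalar_curvature g p) *: g c p.

End manifold_theory.

Arguments vector_field {R n} M.
Arguments riemannian_metric {R n} M.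

Section smooth_on_theory.
Context {R : realType}.

Lemma near_eq_differentiable (V : normedModType R) (f g : V -> R) x :
  (\near x, f x = g x) -> differentiable f x -> differentiable g x.
Proof.
move=> fg df.
have fgx : f x = g x := nbhs_singleton fg.
have cdf : continuous ('d f x) by case/diff_locallyP: df.
have E : g \o shift x = cst (g x) + 'd f x +o_ 0 id.
  apply/eqaddoP => e e0.
  have /diff_locally/eqaddoP/(_ e e0) := df.
  apply: filter_app; move: fg; rewrite (near_shift 0) subr0.
  by apply: filterS => y /= fgy; rewrite !fctE /= -fgx -fgy.
have Ed := diff_unique cdf E.
by apply/diff_locallyP; rewrite Ed.
Qed.

Lemma class_C_ext n k (U : set 'rV[R]_n) (f g : 'rV[R]_n -> R) : open U ->
  (forall x, U x -> f x = g x) -> class_C k U f -> class_C k U g.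
Proof.
move=> oU; elim: k f g => [|k IH] f g fg.
  move=> cf x Ux; have near_fg : \near x, f x = g x.
    by apply: filterS (open_nbhs_nbhs (conj oU Ux)) => y /fg.
  have := cf x Ux; rewrite /prop_for /continuous_at -(fg x Ux).
  by move=> cfx; apply: cvg_trans cfx; exact: near_eq_cvg near_fg.
move=> [df Df]; split=> [x Ux|i].
  apply: near_eq_differentiable (df x Ux).
  by apply: filterS (open_nbhs_nbhs (conj oU Ux)) => y /fg.
apply: IH (Df i) => x Ux; apply: near_eq_derive.
by apply: filterS (open_nbhs_nbhs (conj oU Ux)) => y /fg.
Qed.

Lemma smooth_on_ext n (U : set 'rV[R]_n) (f g : 'rV[R]_n -> R) : open U ->
  (forall x, U x -> f x = g x) -> smooth_on U f -> smooth_on U g.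
Proof. by move=> oU fg sf k; apply: class_C_ext (sf k). Qed.

Lemma class_CW n k (U : set 'rV[R]_n) f : class_C k.+1 U f -> class_C k U f.
Proof.
elim: k f => [|k IH] f [df Df].
  by move=> x Ux; apply: differentiable_continuous; exact: df.
by split=> // i; apply/IH/Df.
Qed.

Lemma class_C_cst n k (U : set 'rV[R]_n) (a : R) : class_C k U (cst a).
Proof.
elim: k a => [|k IH] a; first by move=> x _; exact: cst_continuous.
split=> [x _|i]; first exact: differentiable_cst.
rewrite (_ : 'D_ _ _ = cst 0) //; apply/funext => x.
exact: derive_cst.
Qed.

Lemma class_CD n k (U : set 'rV[R]_n) (f g : 'rV[R]_n -> R) : open U ->
  class_C k U f -> class_C k U g -> class_C k U (fun x => f x + g x).
Proof.
move=> oU; elim: k f g => [|k IH] f g.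
  by move=> cf cg x Ux; exact: (cvgD (cf x Ux) (cg x Ux)).
move=> [df Df] [dg Dg]; split=> [x Ux|i].
  exact: differentiableD (df x Ux) (dg x Ux).
apply: class_C_ext (IH _ _ (Df i) (Dg i)) => // x Ux.
by rewrite -deriveD //; apply: diff_derivable; [exact: df|exact: dg].
Qed.

Lemma class_CM n k (U : set 'rV[R]_n) (f g : 'rV[R]_n -> R) : open U ->
  class_C k U f -> class_C k U g -> class_C k U (fun x => f x * g x).
Proof.
move=> oU; elim: k f g => [|k IH] f g.
  by move=> cf cg x Ux; exact: (cvgM (cf x Ux) (cg x Ux)).
move=> Cf Cg; move: (Cf) (Cg) => [df Df] [dg Dg]; split=> [x Ux|i].
  exact: differentiableM (df x Ux) (dg x Ux).
apply: class_C_ext (class_CD oU (IH _ _ (class_CW Cf) (Dg i))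
                                (IH _ _ (class_CW Cg) (Df i))) => // x Ux.
by rewrite -[RHS]/('D_ _ (f * g) x) deriveM //; apply: diff_derivable;
  [exact: df|exact: dg].
Qed.

Lemma smooth_on_cst n (U : set 'rV[R]_n) (a : R) : smooth_on U (cst a).
Proof. by move=> k; exact: class_C_cst. Qed.

Lemma smooth_onD n (U : set 'rV[R]_n) (f g : 'rV[R]_n -> R) : open U ->
  smooth_on U f -> smooth_on U g -> smooth_on U (fun x => f x + g x).
Proof. by move=> oU sf sg k; exact: class_CD. Qed.

Lemma smooth_onM n (U : set 'rV[R]_n) (f g : 'rV[R]_n -> R) : open U ->
  smooth_on U f -> smooth_on U g -> smooth_on U (fun x => f x * g x).
Proof. by move=> oU sf sg k; exact: class_CM. Qed.

Lemma derive_linear (V W : normedModType R) (L : {linear V -> W}) (f : W -> R)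
  (v z : V) : 'D_v (f \o L) z = 'D_(L v) f (L z).
Proof.
rewrite /derive.
suff -> : (fun h : R => h^-1 *: (((f \o L) \o shift z) (h *: v) - (f \o L) z))
        = (fun h => h^-1 *: ((f \o shift (L z)) (h *: L v) - f (L z))) by [].
apply/funext => h /=.
by have -> : L (h *: v + z) = h *: L v + L z by rewrite linearD linearZZ.
Qed.

Section product_coordinates.
Variables n1 n2 : nat.
Implicit Types (x : 'rV[R]_n1) (y : 'rV[R]_n2) (z : 'rV[R]_(n1 + n2)).

Lemma delta_lshift (i : 'I_n1) :
  delta_mx 0 (lshift n2 i) = row_mx (delta_mx 0 i) 0 :> 'rV[R]_(n1 + n2).
Proof.
apply/rowP => j; rewrite !mxE eqxx /=; case: split_ordP => k ->; rewrite !mxE.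
  by rewrite eqxx /= (inj_eq (@lshift_inj _ _)).
by rewrite eq_rlshift.
Qed.

Lemma delta_rshift (i : 'I_n2) :
  delta_mx 0 (rshift n1 i) = row_mx 0 (delta_mx 0 i) :> 'rV[R]_(n1 + n2).
Proof.
apply/rowP => j; rewrite !mxE eqxx /=; case: split_ordP => k ->; rewrite !mxE.
  by rewrite eq_lrshift.
by rewrite eqxx /= (inj_eq (@rshift_inj _ _)).
Qed.

Lemma derive_lsubmx_l (f : 'rV[R]_n1 -> R) i z :
  'D_(delta_mx 0 (lshift n2 i)) (f \o lsubmx) z
  = 'D_(delta_mx 0 i) f (lsubmx z).
Proof. by rewrite derive_linear delta_lshift /= row_mxKl. Qed.

Lemma derive_lsubmx_r (f : 'rV[R]_n1 -> R) i z :
  'D_(delta_mx 0 (rshift n1 i)) (f \o lsubmx) z = 0.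
Proof. by rewrite derive_linear delta_rshift /= row_mxKl derive0. Qed.

Lemma derive_rsubmx_r (f : 'rV[R]_n2 -> R) i z :
  'D_(delta_mx 0 (rshift n1 i)) (f \o rsubmx) z
  = 'D_(delta_mx 0 i) f (rsubmx z).
Proof. by rewrite derive_linear delta_rshift /= row_mxKr. Qed.

Lemma derive_rsubmx_l (f : 'rV[R]_n2 -> R) i z :
  'D_(delta_mx 0 (lshift n2 i)) (f \o rsubmx) z = 0.
Proof. by rewrite derive_linear delta_lshift /= row_mxKr derive0. Qed.

Lemma smooth_on_lsubmx (U : set 'rV[R]_n1) (V : set 'rV[R]_(n1 + n2)) f :
  (forall z, V z -> U (lsubmx z)) ->
  smooth_on U f -> smooth_on V (f \o lsubmx).
Proof.
move=> VU sf k; have := sf k; elim: k f {sf} => [|k IH] f.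
  move=> cf z Vz; apply: continuous_comp; first exact: continuous_lsubmx.
  exact/cf/VU.
move=> [df Df]; split=> [z Vz|i].
  apply: differentiable_comp; first exact: (@differentiable_lsubmx _ 1).
  exact/df/VU.
case: (split_ordP i) => j ->.
  rewrite (_ : 'D_ _ _ = 'D_(delta_mx 0 j) f \o lsubmx); first exact/IH/Df.
  by apply/funext => z; exact: derive_lsubmx_l.
rewrite (_ : 'D_ _ _ = cst 0); first exact: class_C_cst.
by apply/funext => z; exact: derive_lsubmx_r.
Qed.

Lemma smooth_on_rsubmx (U : set 'rV[R]_n2) (V : set 'rV[R]_(n1 + n2)) f :
  (forall z, V z -> U (rsubmx z)) ->
  smooth_on U f -> smooth_on V (f \o rsubmx).
Proof.
move=> VU sf k; have := sf k; elim: k f {sf} => [|k IH] f.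
  move=> cf z Vz; apply: continuous_comp; first exact: continuous_rsubmx.
  exact/cf/VU.
move=> [df Df]; split=> [z Vz|i].
  apply: differentiable_comp; first exact: (@differentiable_rsubmx _ 1).
  exact/df/VU.
case: (split_ordP i) => j ->.
  rewrite (_ : 'D_ _ _ = cst 0); first exact: class_C_cst.
  by apply/funext => z; exact: derive_rsubmx_l.
rewrite (_ : 'D_ _ _ = 'D_(delta_mx 0 j) f \o rsubmx); first exact/IH/Df.
by apply/funext => z; exact: derive_rsubmx_r.
Qed.

Lemma row_mx_continuous (T : topologicalType) (f : T -> 'rV[R]_n1)
    (g : T -> 'rV[R]_n2) t : {for t, continuous f} -> {for t, continuous g} ->
  {for t, continuous (fun s => row_mx (f s) (g s))}.
Proof.
move=> cf cg; apply/cvg_ballP => e e0.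
have /cvg_ballP/(_ e e0) cf' := cf; have /cvg_ballP/(_ e e0) cg' := cg.
near=> s; split=> // i j; rewrite !mxE; case: split_ordP => k _.
  by have [_] : ball (f t) e (f s) by near: s.
by have [_] : ball (g t) e (g s) by near: s.
Unshelve. all: by end_near. Qed.

End product_coordinates.
End smooth_on_theory.

Section product_manifold.
Context {R : realType} {n1 n2 : nat} (M1 : manifold R n1) (M2 : manifold R n2).

Let T := (M1 * M2)%type.
Implicit Types (c d : chart M1 * chart M2) (p : T).

Let pdom c : set T := dom c.1 `*` dom c.2.

Let pcoord c p : 'rV[R]_(n1 + n2) := row_mx (coord c.1 p.1) (coord c.2 p.2).

Let pparam c (z : 'rV[R]_(n1 + n2)) : T :=
  (param c.1 (lsubmx z), param c.2 (rsubmx z)).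

Let image_pcoord (A1 : set M1) (A2 : set M2) c :
  pcoord c @` (A1 `*` A2) = [set z | (coord c.1 @` A1) (lsubmx z) /\
                                      (coord c.2 @` A2) (rsubmx z)].
Proof.
apply/seteqP; split=> [_ [p [A1p A2p] <-]|z [[p1 A1p e1] [p2 A2p e2]]].
  by split; rewrite /= ?row_mxKl ?row_mxKr; [exists p.1|exists p.2].
by exists (p1, p2) => //; rewrite /pcoord /= e1 e2 hsubmxK.
Qed.

Let pnonempty : [set: T] !=set0.
Proof.
have [p1 _] := manifold_nonempty M1; have [p2 _] := manifold_nonempty M2.
by exists (p1, p2).
Qed.

Let phausdorff : hausdorff_space T.
Proof.
move=> [p1 p2] [q1 q2] cl; congr pair.
  apply: (@manifold_hausdorff _ _ M1) => A B Ap Bq.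
  have [] := cl (A `*` setT) (B `*` setT).
  - by exists (A, setT) => //; split => //; exact: filterT.
  - by exists (B, setT) => //; split => //; exact: filterT.
  by move=> x [[Ax _] [Bx _]]; exists x.1.
apply: (@manifold_hausdorff _ _ M2) => A B Ap Bq.
have [] := cl (setT `*` A) (setT `*` B).
- by exists (setT, A) => //; split => //; exact: filterT.
- by exists (setT, B) => //; split => //; exact: filterT.
by move=> x [[_ Ax] [_ Bx]]; exists x.2.
Qed.

Let open_setX (A1 : set M1) (A2 : set M2) :
  open A1 -> open A2 -> open (A1 `*` A2 : set T).
Proof.
move=> o1 o2; rewrite openE => -[x y] [/= Ax Ay].
by exists (A1, A2) => //; split; apply: open_nbhs_nbhs.
Qed.

Let psecond_countable : @second_countable T.
Proof.
have [B1 cB1 [oB1 bB1]] := @manifold_second_countable _ _ M1.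
have [B2 cB2 [oB2 bB2]] := @manifold_second_countable _ _ M2.
exists [set A.1 `*` A.2 | A in B1 `*` B2].
  apply: sub_countable (card_image_le _ _) _.
  exact: countableX.
split=> [_ [A [BA1 BA2] <-]|[x y] W [[W1 W2] /= [W1x W2y] W12]].
  by apply: open_setX; [exact: oB1|exact: oB2].
have [U1 [BU1 U1x] U1W] := bB1 x W1 W1x.
have [U2 [BU2 U2y] U2W] := bB2 y W2 W2y.
exists (U1 `*` U2); first by split=> //; exists (U1, U2).
by move=> z [/U1W W1z /U2W W2z]; apply: W12.
Qed.

Let pcover p : exists c, pdom c p.
Proof.
have [c1 c1p] := chart_cover p.1; have [c2 c2p] := chart_cover p.2.
by exists (c1, c2).
Qed.

Let pdom_open c : open (pdom c).
Proof. by apply: open_setX; exact: dom_open. Qed.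

Let ppreim_open (A1 : set 'rV[R]_n1) (A2 : set 'rV[R]_n2) :
  open A1 -> open A2 ->
  open [set z : 'rV[R]_(n1 + n2) | A1 (lsubmx z) /\ A2 (rsubmx z)].
Proof.
move=> o1 o2; apply: openI.
  by have /continuousP := @continuous_lsubmx R 1 n1 n2; apply.
by have /continuousP := @continuous_rsubmx R 1 n1 n2; apply.
Qed.

Let pcoord_open c : open (pcoord c @` pdom c).
Proof. by rewrite image_pcoord; apply: ppreim_open; exact: coord_open. Qed.

Let pcoordK c p : pdom c p -> pparam c (pcoord c p) = p.
Proof.
case: p => p1 p2 [/= d1 d2].
by rewrite /pparam /pcoord row_mxKl row_mxKr !coordK.
Qed.

Let pcoord_continuous c p : pdom c p -> {for p, continuous (pcoord c)}.
Proof.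
move=> [d1 d2]; apply: row_mx_continuous.
  by apply: (@continuous_comp _ _ _ fst); [exact: cvg_fst|exact: coord_continuous].
by apply: (@continuous_comp _ _ _ snd); [exact: cvg_snd|exact: coord_continuous].
Qed.

Let pparam_continuous c p : pdom c p ->
  {for pcoord c p, continuous (pparam c)}.
Proof.
move=> [d1 d2].
have c1 : {for pcoord c p, continuous (param c.1 \o lsubmx)}.
  apply: continuous_comp; first exact: continuous_lsubmx.
  by rewrite row_mxKl; exact: param_continuous.
have c2 : {for pcoord c p, continuous (param c.2 \o rsubmx)}.
  apply: continuous_comp; first exact: continuous_rsubmx.
  by rewrite row_mxKr; exact: param_continuous.
exact: cvg_pair c1 c2.
Qed.

Let ptransition_smooth c d k : smooth_on (pcoord c @` (pdom c `&` pdom d))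
  (fun z => pcoord d (pparam c z) 0 k).
Proof.
rewrite (_ : pdom c `&` pdom d =
  (dom c.1 `&` dom d.1) `*` (dom c.2 `&` dom d.2)); last first.
  by apply/seteqP; split=> p [[? ?] [? ?]].
rewrite image_pcoord; case: (split_ordP k) => j ->.
  rewrite (_ : (fun _ => _) =
    (fun x => coord d.1 (param c.1 x) 0 j) \o lsubmx); last first.
    by apply/funext => z; rewrite /pcoord row_mxEl.
  by apply: smooth_on_lsubmx (transition_smooth c.1 d.1 j) => z [].
rewrite (_ : (fun _ => _) =
  (fun x => coord d.2 (param c.2 x) 0 j) \o rsubmx); last first.
  by apply/funext => z; rewrite /pcoord row_mxEr.
by apply: smooth_on_rsubmx (transition_smooth c.2 d.2 j) => z [].
Qed.

Definition prod_manifold : manifold R (n1 + n2) :=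
  @Manifold R (n1 + n2) T (chart M1 * chart M2)%type pdom pcoord pparam
    pnonempty phausdorff psecond_countable pcover pdom_open pcoord_open
    pcoordK pcoord_continuous pparam_continuous ptransition_smooth.

End product_manifold.

Section manifold_operations.
Context {R : realType} {n : nat} {M : manifold R n}.
Implicit Types (c : chart M) (F G : M -> R).

Lemma smooth_in_cst c (a : R) : smooth_in c (cst a : M -> R).
Proof. exact: smooth_on_cst. Qed.

Lemma smooth_inD c F G : smooth_in c F -> smooth_in c G ->
  smooth_in c (fun p => F p + G p).
Proof. by move=> sF sG; apply: smooth_onD => //; exact: coord_open. Qed.

Lemma smooth_inM c F G : smooth_in c F -> smooth_in c G ->
  smooth_in c (fun p => F p * G p).
Proof. by move=> sF sG; apply: smooth_onM => //; exact: coord_open. Qed.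

Record warping_function := WarpingFunction {
  warping_fun :> M -> R;
  warping_smooth : smooth_fun warping_fun;
  warping_pos : forall p, 0 < warping_fun p
}.

Section vf_add.
Variables X Y : vector_field M.

Let vf_add_smooth c k : smooth_in c (fun p => (X c p + Y c p) 0 k).
Proof.
rewrite (_ : (fun _ => _) = (fun p => X c p 0 k + Y c p 0 k)).
  by apply: smooth_inD; exact: vf_smooth.
by apply/funext => p; rewrite mxE.
Qed.

Let vf_add_law c d p : dom c p -> dom d p ->
  X d p + Y d p = (X c p + Y c p) *m jac c d p.
Proof. by move=> cp dp; rewrite mulmxDl -!vf_law. Qed.

Definition vf_add : vector_field M := VectorField vf_add_smooth vf_add_law.

End vf_add.
End manifold_operations.

Arguments warping_function {R n} M.

Section product_operations.
Context {R : realType} {n1 n2 : nat} {M1 : manifold R n1} {M2 : manifold R n2}.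
Local Notation P := (prod_manifold M1 M2).
Implicit Types (c d : chart P) (p : P).

Lemma pd_fst_l c i (F : M1 -> R) p :
  pd c (lshift n2 i) (fun q : P => F q.1) p = pd c.1 i F p.1.
Proof.
rewrite [LHS](derive_lsubmx_l (F \o param c.1)).
by rewrite /pd /= row_mxKl.
Qed.

Lemma pd_fst_r c i (F : M1 -> R) p :
  pd c (rshift n1 i) (fun q : P => F q.1) p = 0.
Proof. exact: (derive_lsubmx_r (F \o param c.1)). Qed.

Lemma pd_snd_l c i (F : M2 -> R) p :
  pd c (lshift n2 i) (fun q : P => F q.2) p = 0.
Proof. exact: (derive_rsubmx_l (F \o param c.2)). Qed.

Lemma pd_snd_r c i (F : M2 -> R) p :
  pd c (rshift n1 i) (fun q : P => F q.2) p = pd c.2 i F p.2.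
Proof.
rewrite [LHS](derive_rsubmx_r (F \o param c.2)).
by rewrite /pd /= row_mxKr.
Qed.

Lemma jac_prod c d p :
  jac c d p = block_mx (jac c.1 d.1 p.1) 0 0 (jac c.2 d.2 p.2).
Proof.
apply/matrixP => i k; rewrite mxE.
case: (split_ordP i) => i' ->; case: (split_ordP k) => k' ->.
- rewrite block_mxEul mxE -pd_fst_l; congr pd.
  by apply/funext => q; rewrite /= row_mxEl.
- rewrite block_mxEur mxE -(pd_snd_l c i' (fun q => coord d.2 q 0 k') p).
  by congr pd; apply/funext => q; rewrite /= row_mxEr.
- rewrite block_mxEdl mxE -(pd_fst_r c i' (fun q => coord d.1 q 0 k') p).
  by congr pd; apply/funext => q; rewrite /= row_mxEl.
- rewrite block_mxEdr mxE -pd_snd_r; congr pd.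
  by apply/funext => q; rewrite /= row_mxEr.
Qed.

Lemma smooth_in_fst c (F : M1 -> R) :
  smooth_in c.1 F -> smooth_in c (fun q : P => F q.1).
Proof.
move=> sF; apply: (smooth_on_lsubmx _ sF) => _ [p [p1 p2] <-].
by rewrite /= row_mxKl; exists p.1.
Qed.

Lemma smooth_in_snd c (F : M2 -> R) :
  smooth_in c.2 F -> smooth_in c (fun q : P => F q.2).
Proof.
move=> sF; apply: (smooth_on_rsubmx _ sF) => _ [p [p1 p2] <-].
by rewrite /= row_mxKr; exists p.2.
Qed.

Section lift_fst.
Variable X : vector_field M1.

Let comp : chart P -> P -> 'rV[R]_(n1 + n2) :=
  fun c p => row_mx (X c.1 p.1) 0.

Let smooth c k : smooth_in c (fun p => comp c p 0 k).
Proof.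
case: (split_ordP k) => j ->.
  rewrite (_ : (fun _ => _) = (fun p : P => X c.1 p.1 0 j)).
    by apply: (smooth_in_fst (F := fun q => X c.1 q 0 j)); exact: vf_smooth.
  by apply/funext => p; rewrite /comp row_mxEl.
rewrite (_ : (fun _ => _) = cst 0); first exact: smooth_in_cst.
by apply/funext => p; rewrite /comp row_mxEr mxE.
Qed.

Let law c d p : dom c p -> dom d p -> comp d p = comp c p *m jac c d p.
Proof.
move=> [c1 _] [d1 _]; rewrite jac_prod /comp mul_row_block.
by rewrite !mulmx0 !mul0mx !addr0 -vf_law.
Qed.

Definition lift_fst : vector_field P := VectorField smooth law.

End lift_fst.

Section lift_snd.
Variable X : vector_field M2.

Let comp : chart P -> P -> 'rV[R]_(n1 + n2) :=
  fun c p => row_mx 0 (X c.2 p.2).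

Let smooth c k : smooth_in c (fun p => comp c p 0 k).
Proof.
case: (split_ordP k) => j ->.
  rewrite (_ : (fun _ => _) = cst 0); first exact: smooth_in_cst.
  by apply/funext => p; rewrite /comp row_mxEl mxE.
rewrite (_ : (fun _ => _) = (fun p : P => X c.2 p.2 0 j)).
  by apply: (smooth_in_snd (F := fun q => X c.2 q 0 j)); exact: vf_smooth.
by apply/funext => p; rewrite /comp row_mxEr.
Qed.

Let law c d p : dom c p -> dom d p -> comp d p = comp c p *m jac c d p.
Proof.
move=> [_ c2] [_ d2]; rewrite jac_prod /comp mul_row_block.
by rewrite !mulmx0 !mul0mx !add0r -vf_law.
Qed.

Definition lift_snd : vector_field P := VectorField smooth law.

End lift_snd.

(* pullbacks of covariant 2-tensors by the projections: the coordinates of M1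
   are the first n1 coordinates of a product chart, those of M2 the last n2 *)
Definition pull_fst (T : chart M1 -> M1 -> 'M[R]_n1) :
    chart P -> P -> 'M[R]_(n1 + n2) :=
  fun c p => block_mx (T c.1 p.1) 0 0 0.

Definition pull_snd (T : chart M2 -> M2 -> 'M[R]_n2) :
    chart P -> P -> 'M[R]_(n1 + n2) :=
  fun c p => block_mx 0 0 0 (T c.2 p.2).

Section doubly_warped.
Variables (g1 : riemannian_metric M1) (g2 : riemannian_metric M2).
Variables (f1 : warping_function M1) (f2 : warping_function M2).

Let comp : chart P -> P -> 'M[R]_(n1 + n2) := fun c p =>
  f2 p.2 ^+ 2 *: pull_fst g1 c p + f1 p.1 ^+ 2 *: pull_snd g2 c p.

Let compE c p : comp c p = block_mx (f2 p.2 ^+ 2 *: g1 c.1 p.1) 0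
                                    0 (f1 p.1 ^+ 2 *: g2 c.2 p.2).
Proof.
rewrite /comp /pull_fst /pull_snd !scale_block_mx add_block_mx.
by rewrite !scaler0 !addr0 !add0r.
Qed.

Let smooth c i j : smooth_in c (fun p => comp c p i j).
Proof.
have sf1 : smooth_in c (fun p : P => f1 p.1).
  by apply: smooth_in_fst; exact: warping_smooth.
have sf2 : smooth_in c (fun p : P => f2 p.2).
  by apply: smooth_in_snd; exact: warping_smooth.
rewrite (_ : (fun _ => _) = (fun p : P =>
  f2 p.2 * f2 p.2 * pull_fst g1 c p i j
  + f1 p.1 * f1 p.1 * pull_snd g2 c p i j)); last first.
  by apply/funext => p; rewrite /comp !mxE !expr2.
apply: smooth_inD; apply: smooth_inM; do ?exact: smooth_inM.
  case: (split_ordP i) => i' ->; case: (split_ordP j) => j' ->;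
    try (rewrite (_ : (fun _ => _) = cst 0); first exact: smooth_in_cst;
      by apply/funext => p;
        rewrite /pull_fst ?block_mxEur ?block_mxEdl ?block_mxEdr mxE).
  rewrite (_ : (fun _ => _) = (fun p : P => g1 c.1 p.1 i' j')).
    apply: (smooth_in_fst (F := fun q => g1 c.1 q i' j')).
    exact: metric_smooth.
  by apply/funext => p; rewrite /pull_fst block_mxEul.
case: (split_ordP i) => i' ->; case: (split_ordP j) => j' ->;
  try (rewrite (_ : (fun _ => _) = cst 0); first exact: smooth_in_cst;
    by apply/funext => p;
      rewrite /pull_snd ?block_mxEur ?block_mxEdl ?block_mxEul mxE).
rewrite (_ : (fun _ => _) = (fun p : P => g2 c.2 p.2 i' j')).
  apply: (smooth_in_snd (F := fun q => g2 c.2 q i' j')).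
  exact: metric_smooth.
by apply/funext => p; rewrite /pull_snd block_mxEdr.
Qed.

Let law c d p : dom c p -> dom d p ->
  comp c p = jac c d p *m comp d p *m (jac c d p)^T.
Proof.
move=> [c1 c2] [d1 d2]; rewrite !compE jac_prod tr_block_mx !mulmx_block.
rewrite !(trmx0, mulmx0, mul0mx, addr0, add0r).
by rewrite -!scalemxAr -!scalemxAl -!metric_law.
Qed.

Let sym c p : dom c p -> (comp c p)^T = comp c p.
Proof.
by move=> [c1 c2]; rewrite !compE tr_block_mx !trmx0 !linearZ /= !metric_sym.
Qed.

Let pos c p : dom c p -> forall v : 'rV[R]_(n1 + n2), v != 0 ->
  0 < (v *m comp c p *m v^T) 0 0.
Proof.
move=> [c1 c2] v v0; rewrite compE -(hsubmxK v) tr_row_mx mul_row_block.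
have scE (a : R) (A : 'M[R]_1) : (a *: A) 0 0 = a * A 0 0 by rewrite mxE.
rewrite !mulmx0 addr0 add0r mul_row_col mxE -!scalemxAr -!scalemxAl !scE.
have ge0 m (M : manifold R m) (g : riemannian_metric M) e q (w : 'rV[R]_m) :
    dom e q -> 0 <= (w *m g e q *m w^T) 0 0.
  move=> eq; have [->|w0] := eqVneq w 0; first by rewrite !mul0mx mxE.
  by apply/ltW/metric_pos.
have f1p : 0 < f1 p.1 ^+ 2 by rewrite exprn_gt0// warping_pos.
have f2p : 0 < f2 p.2 ^+ 2 by rewrite exprn_gt0// warping_pos.
have [v1|v1] := eqVneq (lsubmx v) 0; last first.
  rewrite ltr_pwDl//; first by rewrite mulr_gt0// metric_pos.
  by rewrite mulr_ge0 ?(ltW f1p)// ge0.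
have v2 : rsubmx v != 0.
  apply: contra v0 => /eqP v2.
  by rewrite -(hsubmxK v) v1 v2 row_mx0.
rewrite ltr_wpDl//; last by rewrite mulr_gt0// metric_pos.
by rewrite mulr_ge0 ?(ltW f2p)// ge0.
Qed.

Definition doubly_warped : riemannian_metric P :=
  RiemannianMetric smooth law sym pos.

End doubly_warped.
End product_operations.

(* Main.v *)
Require Import Defs.
From mathcomp Require Import all_boot all_order all_algebra.
From mathcomp Require Import all_classical all_reals all_analysis.
From mathcomp Require Import ring.

Set Implicit Arguments.
Unset Strict Implicit.
Unset Printing Implicit Defensive.

Import Order.TTheory GRing.Theory Num.Theory.
Import numFieldNormedType.Exports.

Local Open Scope classical_set_scope.
Local Open Scope ring_scope.

(** The Lie derivative of a covariant tensor along [zeta = zeta1 + zeta2]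
respects the product structure: since the components of [zeta1] depend only on
the first factor and those of [zeta2] only on the second, the (M1, M1) block of
[lie zeta T] is determined by the (M1, M1) block of [T]. If that block is
[a *: A], with [a] a function on M2 and [A] a tensor on M1, the Leibniz rule
gives [a *: lie zeta1 A + zeta2(a) *: A] ([lie_ulsubmx]). The metric has
(M1, M1) block [F2 *: g1], where [F2 = f2 ^+ 2], so two applications yield
[[
  F2 *: L(L g1) + 2 zeta2(F2) *: L g1 + zeta2(zeta2(F2)) *: g1,   L = lie zeta1,
]]
([ulsubmx_lie_lie_doubly_warped]), and this vanishes when [zeta] is 2-Killing.
As [F2] is nowhere zero, the relation expresses [L(L g1)] through [L g1] and
[g1]; substituting it in the soliton equation turns that equation into
[(lambda F2 - 2 zeta2(F2)) *: L g1 = ((mu - r1) F2 + zeta2(zeta2(F2))) *: g1]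
([soliton_equationE]), whence both implications, with the same constants. The
implication towards the soliton equation uses the relation at an arbitrary
point of M2, which is nonempty.

The analytic input is that [vf_act] may be computed in any chart around the
point ([vf_actE], by the chain rule) and therefore preserves smoothness, which
is what the second application of the Leibniz rule requires. *)

(* [coord] also names the coordinates of a vector in a basis. *)
Local Notation coord := Defs.coord.

(** * The chain rule in coordinates *)

Section chain_rule.
Context {R : realType}.

Lemma differentiable_rV (V : normedModType R) n (h : V -> 'rV[R]_n) x :
  (forall k, differentiable (fun y => h y 0 k) x) -> differentiable h x.
Proof.
move=> dh.
rewrite (_ : h = \sum_(k < n) (fun y => h y 0 k *: delta_mx 0 k)); last first.
  by apply/funext => y; rewrite fct_sumE -row_sum_delta.
by apply: differentiable_sum => k; exact: differentiableZl.
Qed.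

Lemma derive_coords n (G : 'rV[R]_n -> R) y w : differentiable G y ->
  'D_w G y = \sum_(k < n) w 0 k * 'D_(delta_mx 0 k) G y.
Proof.
move=> dG; rewrite deriveE// {1}(row_sum_delta w) linear_sum.
by apply: eq_bigr => k _; rewrite linearZ deriveE.
Qed.

Lemma derive_comp_rV (V : normedModType R) n (h : V -> 'rV[R]_n)
    (G : 'rV[R]_n -> R) x v :
  (forall k, differentiable (fun y => h y 0 k) x) -> differentiable G (h x) ->
  'D_v (G \o h) x
  = \sum_(k < n) 'D_v (fun y => h y 0 k) x * 'D_(delta_mx 0 k) G (h x).
Proof.
move=> dhk dG; have dh := differentiable_rV dhk.
rewrite deriveE; last exact: differentiable_comp.
rewrite diff_comp//= -!deriveE// derive_coords// derive_mx.
  by apply: eq_bigr => k _; rewrite mxE.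
exact: diff_derivable.
Qed.

End chain_rule.

(** * Calculus in a chart *)

Section chart_calculus.
Context {R : realType} {n : nat} {M : manifold R n}.
Implicit Types (c d : chart M) (p : M) (F G : M -> R) (X : vector_field M).

Lemma near_param_dom c d p : dom c p -> dom d p ->
  \forall z \near coord c p, dom d (param c z).
Proof.
move=> cp dp; apply: (param_continuous cp).
by rewrite coordK//; apply: open_nbhs_nbhs; split => //; exact: dom_open.
Qed.

(** On the image of the chart domain [param c] is inverse to [coord c], so
values of a function outside the domain are invisible to [smooth_in]. *)
Lemma smooth_in_ext c F G : (forall p, dom c p -> F p = G p) ->
  smooth_in c F -> smooth_in c G.
Proof.
move=> FG; apply: smooth_on_ext; first exact: coord_open.
by move=> _ [p cp <-] /=; rewrite coordK// FG.
Qed.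

Lemma smooth_in_sum c m (F : 'I_m -> M -> R) :
  (forall k, smooth_in c (F k)) -> smooth_in c (fun p => \sum_(k < m) F k p).
Proof.
elim: m F => [|m IH] F sF.
  apply: smooth_in_ext (smooth_in_cst c 0) => p _.
  by rewrite big_ord0.
apply: smooth_in_ext (smooth_inD (IH _ (fun k => sF (widen_ord (leqnSn m) k)))
                                (sF ord_max)) => p _.
by rewrite big_ord_recr.
Qed.

Lemma smooth_in_differentiable c F p : dom c p -> smooth_in c F ->
  differentiable (F \o param c) (coord c p).
Proof. by move=> cp /(_ 1%N)[dF _]; apply: dF; exists p. Qed.

Lemma smooth_in_pd c i F : smooth_in c F -> smooth_in c (pd c i F).
Proof.
move=> sF; apply: (@smooth_on_ext _ _ _ ('D_(delta_mx 0 i) (F \o param c))).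
- exact: coord_open.
- by move=> _ [p cp <-] /=; rewrite /pd coordK.
- by move=> k; have [_ /(_ i)] := sF k.+1.
Qed.

(** [pd] differentiates [F \o param c], and [param c] maps points close to
[coord c p] into the open domain of [c]. *)
Lemma pd_ext c i F G p : dom c p -> (forall q, dom c q -> F q = G q) ->
  pd c i F p = pd c i G p.
Proof.
move=> cp FG; apply: near_eq_derive.
by apply: filterS (near_param_dom cp cp) => z /FG.
Qed.

Lemma pdD c i F G p : dom c p -> smooth_in c F -> smooth_in c G ->
  pd c i (fun q => F q + G q) p = pd c i F p + pd c i G p.
Proof.
move=> cp sF sG; rewrite [LHS](@deriveD _ _ _ (F \o param c) (G \o param c))//.
  exact/diff_derivable/smooth_in_differentiable.
exact/diff_derivable/smooth_in_differentiable.
Qed.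

Lemma pdM c i F G p : dom c p -> smooth_in c F -> smooth_in c G ->
  pd c i (fun q => F q * G q) p = F p * pd c i G p + G p * pd c i F p.
Proof.
move=> cp sF sG; rewrite [LHS](@deriveM _ _ (F \o param c) (G \o param c)).
- by rewrite /= coordK.
- exact/diff_derivable/smooth_in_differentiable.
- exact/diff_derivable/smooth_in_differentiable.
Qed.

(** Near [coord c p] one has [F \o param c = (F \o param d) \o (coord d \o
param c)], and the partial derivatives of the transition map are the entries of
[jac c d]. *)
Lemma pd_chain c d i F p : dom c p -> dom d p -> smooth_in d F ->
  pd c i F p = \sum_(k < n) jac c d p i k * pd d k F p.
Proof.
move=> cp dp sF.
have -> : pd c i F p
    = 'D_(delta_mx 0 i) ((F \o param d) \o (coord d \o param c)) (coord c p).
  apply: near_eq_derive; apply: filterS (near_param_dom cp dp) => z dz /=.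
  by rewrite coordK.
rewrite derive_comp_rV.
- by apply: eq_bigr => k _; rewrite mxE /= coordK.
- move=> k; have [] := transition_smooth c d k 1 => dh _.
  by apply: dh; exists p.
- by rewrite /= coordK//; exact: smooth_in_differentiable.
Qed.

(** The Jacobian in the transformation law of the components of [X] is the one
that the chain rule produces for the partial derivatives of [F]. *)
Lemma vf_actE X F c p : smooth_fun F -> dom c p ->
  vf_act X F p = \sum_(k < n) X c p 0 k * pd c k F p.
Proof.
move=> sF cp; have dp := chart_atP p; rewrite /vf_act; set d := chart_at p.
under [RHS]eq_bigr => i _ do rewrite (pd_chain i cp dp (sF d)) mulr_sumr.
rewrite exchange_big; apply: eq_bigr => k _ /=.
rewrite (vf_law X cp dp) mxE mulr_suml.
by apply: eq_bigr => i _; rewrite mulrA.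
Qed.

Lemma vf_act_cst X (a : R) : vf_act X (cst a) = cst 0.
Proof.
apply/funext => p; rewrite /vf_act big1// => k _.
rewrite /pd (_ : _ \o _ = cst a)//.
by rewrite derive_cst mulr0.
Qed.

(** [vf_act] uses a chart that varies with the point; smoothness in [c] becomes
visible after passing to the fixed chart [c]. *)
Lemma smooth_vf_act X F : smooth_fun F -> smooth_fun (vf_act X F).
Proof.
move=> sF c.
apply: (@smooth_in_ext _ (fun p => \sum_(k < n) X c p 0 k * pd c k F p)).
  by move=> p cp; rewrite (vf_actE X sF cp).
apply: smooth_in_sum => k; apply: smooth_inM; first exact: vf_smooth.
exact/smooth_in_pd/sF.
Qed.

Lemma smooth_fun_sqr F : smooth_fun F -> smooth_fun (fun p => F p ^+ 2).
Proof.
by move=> sF c; apply: smooth_in_ext (smooth_inM (sF c) (sF c)) => p _;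
  rewrite expr2.
Qed.

Lemma smooth_lie X (T : chart M -> M -> 'M[R]_n) c :
  (forall i j, smooth_in c (fun p => T c p i j)) ->
  forall i j, smooth_in c (fun p => lie X T c p i j).
Proof.
move=> sT i j; under [F in smooth_in _ F]funext => p do rewrite mxE.
have sX k := vf_smooth X c k.
apply: smooth_in_sum => k; do 2?apply: smooth_inD; apply: smooth_inM => //;
  exact: smooth_in_pd.
Qed.

End chart_calculus.

(** * Lie derivatives on a product *)

Section product_lie.
Context {R : realType} {n1 n2 : nat} {M1 : manifold R n1} {M2 : manifold R n2}.
Local Notation P := (prod_manifold M1 M2).
Variables (X1 : vector_field M1) (X2 : vector_field M2).
Local Notation X := (vf_add (lift_fst X1) (lift_snd X2)).
Implicit Types (c : chart P) (p : P).

Lemma pd_scale_fst_l c k (a : M2 -> R) (A : M1 -> R) p : dom c p ->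
  smooth_in c.2 a -> smooth_in c.1 A ->
  pd c (lshift n2 k) (fun q : P => a q.2 * A q.1) p
  = a p.2 * pd c.1 k A p.1.
Proof.
move=> cp sa sA; rewrite pdM// ?pd_fst_l ?pd_snd_l ?mulr0 ?addr0//.
  exact: smooth_in_snd.
exact: smooth_in_fst.
Qed.

Lemma pd_scale_fst_r c k (a : M2 -> R) (A : M1 -> R) p : dom c p ->
  smooth_in c.2 a -> smooth_in c.1 A ->
  pd c (rshift n1 k) (fun q : P => a q.2 * A q.1) p
  = pd c.2 k a p.2 * A p.1.
Proof.
move=> cp sa sA; rewrite pdM// ?pd_fst_r ?pd_snd_r ?mulr0 ?add0r 1?mulrC//.
  exact: smooth_in_snd.
exact: smooth_in_fst.
Qed.

Lemma pd_scale_snd_l c k (a : M1 -> R) (A : M2 -> R) p : dom c p ->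
  smooth_in c.1 a -> smooth_in c.2 A ->
  pd c (lshift n2 k) (fun q : P => a q.1 * A q.2) p
  = pd c.1 k a p.1 * A p.2.
Proof.
move=> cp sa sA; rewrite pdM// ?pd_fst_l ?pd_snd_l ?mulr0 ?add0r 1?mulrC//.
  exact: smooth_in_fst.
exact: smooth_in_snd.
Qed.

Lemma pd_scale_snd_r c k (a : M1 -> R) (A : M2 -> R) p : dom c p ->
  smooth_in c.1 a -> smooth_in c.2 A ->
  pd c (rshift n1 k) (fun q : P => a q.1 * A q.2) p
  = a p.1 * pd c.2 k A p.2.
Proof.
move=> cp sa sA; rewrite pdM// ?pd_fst_r ?pd_snd_r ?mulr0 ?addr0//.
  exact: smooth_in_fst.
exact: smooth_in_snd.
Qed.

Lemma vf_sum_l c p k : X c p 0 (lshift n2 k) = X1 c.1 p.1 0 k.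
Proof. by rewrite mxE !row_mxEl mxE addr0. Qed.

Lemma vf_sum_r c p k : X c p 0 (rshift n1 k) = X2 c.2 p.2 0 k.
Proof. by rewrite mxE !row_mxEr mxE add0r. Qed.

Lemma pd_vf_sum_ll c p i k :
  pd c (lshift n2 i) (fun q => X c q 0 (lshift n2 k)) p
  = pd c.1 i (fun q => X1 c.1 q 0 k) p.1.
Proof.
under [X in pd _ _ X]funext => q do rewrite vf_sum_l.
exact: (pd_fst_l c i (fun q => X1 c.1 q 0 k)).
Qed.

Lemma pd_vf_sum_lr c p i k :
  pd c (lshift n2 i) (fun q => X c q 0 (rshift n1 k)) p = 0.
Proof.
under [X in pd _ _ X]funext => q do rewrite vf_sum_r.
exact: (pd_snd_l c i (fun q => X2 c.2 q 0 k)).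
Qed.

Lemma pd_vf_sum_rl c p i k :
  pd c (rshift n1 i) (fun q => X c q 0 (lshift n2 k)) p = 0.
Proof.
under [X in pd _ _ X]funext => q do rewrite vf_sum_l.
exact: (pd_fst_r c i (fun q => X1 c.1 q 0 k)).
Qed.

Lemma pd_vf_sum_rr c p i k :
  pd c (rshift n1 i) (fun q => X c q 0 (rshift n1 k)) p
  = pd c.2 i (fun q => X2 c.2 q 0 k) p.2.
Proof.
under [X in pd _ _ X]funext => q do rewrite vf_sum_r.
exact: (pd_snd_r c i (fun q => X2 c.2 q 0 k)).
Qed.

(** The two summands make the lemma applicable to its own output. In the entry
(i, j) with both indices in M1, a summation index in M2 contributes no
derivative of [X], as the components of [X2] are constant along M1; hence the
mixed blocks of [T] never occur, and only [X2(a)] and [X2(b)] remain of that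
part of the sum. *)
Lemma lie_ulsubmx (T : chart P -> P -> 'M[R]_(n1 + n2)) (a b : M2 -> R)
    (A B : chart M1 -> M1 -> 'M[R]_n1) c p : dom c p ->
  smooth_fun a -> smooth_fun b ->
  (forall i j, smooth_in c.1 (fun q => A c.1 q i j)) ->
  (forall i j, smooth_in c.1 (fun q => B c.1 q i j)) ->
  (forall q, dom c q ->
     ulsubmx (T c q) = a q.2 *: A c.1 q.1 + b q.2 *: B c.1 q.1) ->
  ulsubmx (lie X T c p)
  = a p.2 *: lie X1 A c.1 p.1 + vf_act X2 a p.2 *: A c.1 p.1
    + (b p.2 *: lie X1 B c.1 p.1 + vf_act X2 b p.2 *: B c.1 p.1).
Proof.
move=> cp sa sb sA sB TE.
have TijE q i j : dom c q -> T c q (lshift n2 i) (lshift n2 j)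
    = a q.2 * A c.1 q.1 i j + b q.2 * B c.1 q.1 i j.
  by move=> cq; have /matrixP/(_ i j) := TE q cq; rewrite !mxE.
have smul s S : smooth_in c.2 s -> smooth_in c.1 S ->
    smooth_in c (fun q : P => s q.2 * S q.1).
  by move=> ss sS; apply: smooth_inM;
    [exact: smooth_in_snd|exact: smooth_in_fst].
have c2 : dom c.2 p.2 by case: cp.
apply/matrixP => i j; rewrite !mxE big_split_ord/=.
rewrite (vf_actE X2 sa c2) (vf_actE X2 sb c2) !mulr_sumr !mulr_suml.
rewrite addrACA -!big_split/=; congr (_ + _); apply: eq_bigr => k _;
  rewrite (pd_ext _ cp (fun q => @TijE q i j))
    (pdD _ cp (smul _ _ (sa c.2) (sA i j)) (smul _ _ (sb c.2) (sB i j))).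
  rewrite (pd_scale_fst_l k cp (sa c.2) (sA i j)).
  rewrite (pd_scale_fst_l k cp (sb c.2) (sB i j)).
  rewrite !pd_vf_sum_ll vf_sum_l !TijE//.
  ring.
rewrite (pd_scale_fst_r k cp (sa c.2) (sA i j)).
rewrite (pd_scale_fst_r k cp (sb c.2) (sB i j)).
rewrite !pd_vf_sum_lr vf_sum_r.
ring.
Qed.

(** Mirror image of [lie_ulsubmx]: the indices of M2 come last, so the two
halves of the sum exchange their roles. *)
Lemma lie_drsubmx (T : chart P -> P -> 'M[R]_(n1 + n2)) (a b : M1 -> R)
    (A B : chart M2 -> M2 -> 'M[R]_n2) c p : dom c p ->
  smooth_fun a -> smooth_fun b ->
  (forall i j, smooth_in c.2 (fun q => A c.2 q i j)) ->
  (forall i j, smooth_in c.2 (fun q => B c.2 q i j)) ->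
  (forall q, dom c q ->
     drsubmx (T c q) = a q.1 *: A c.2 q.2 + b q.1 *: B c.2 q.2) ->
  drsubmx (lie X T c p)
  = a p.1 *: lie X2 A c.2 p.2 + vf_act X1 a p.1 *: A c.2 p.2
    + (b p.1 *: lie X2 B c.2 p.2 + vf_act X1 b p.1 *: B c.2 p.2).
Proof.
move=> cp sa sb sA sB TE.
have TijE q i j : dom c q -> T c q (rshift n1 i) (rshift n1 j)
    = a q.1 * A c.2 q.2 i j + b q.1 * B c.2 q.2 i j.
  by move=> cq; have /matrixP/(_ i j) := TE q cq; rewrite !mxE.
have smul s S : smooth_in c.1 s -> smooth_in c.2 S ->
    smooth_in c (fun q : P => s q.1 * S q.2).
  by move=> ss sS; apply: smooth_inM;
    [exact: smooth_in_fst|exact: smooth_in_snd].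
have c1 : dom c.1 p.1 by case: cp.
apply/matrixP => i j; rewrite !mxE big_split_ord/=.
rewrite (vf_actE X1 sa c1) (vf_actE X1 sb c1) !mulr_sumr !mulr_suml.
rewrite addrC addrACA -!big_split/=; congr (_ + _); apply: eq_bigr => k _;
  rewrite (pd_ext _ cp (fun q => @TijE q i j))
    (pdD _ cp (smul _ _ (sa c.1) (sA i j)) (smul _ _ (sb c.1) (sB i j))).
  rewrite (pd_scale_snd_r k cp (sa c.1) (sA i j)).
  rewrite (pd_scale_snd_r k cp (sb c.1) (sB i j)).
  rewrite !pd_vf_sum_rr vf_sum_r !TijE//.
  ring.
rewrite (pd_scale_snd_l k cp (sa c.1) (sA i j)).
rewrite (pd_scale_snd_l k cp (sb c.1) (sB i j)).
rewrite !pd_vf_sum_rl vf_sum_l.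
ring.
Qed.

Section doubly_warped_lie.
Variables (g1 : riemannian_metric M1) (g2 : riemannian_metric M2).
Variables (f1 : warping_function M1) (f2 : warping_function M2).
Local Notation g := (doubly_warped g1 g2 f1 f2).
Local Notation F1 := (fun x => f1 x ^+ 2).
Local Notation F2 := (fun x => f2 x ^+ 2).

Let sF1 : smooth_fun F1 := smooth_fun_sqr (@warping_smooth _ _ _ f1).
Let sF2 : smooth_fun F2 := smooth_fun_sqr (@warping_smooth _ _ _ f2).

Lemma doubly_warped_block c p :
  g c p = block_mx (F2 p.2 *: g1 c.1 p.1) 0 0 (F1 p.1 *: g2 c.2 p.2).
Proof.
transitivity (F2 p.2 *: pull_fst g1 c p + F1 p.1 *: pull_snd g2 c p) => //.
rewrite /pull_fst /pull_snd !scale_block_mx add_block_mx.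
by rewrite !scaler0 !addr0 !add0r.
Qed.

(** The cross term [X2(F2) *: lie X1 g1] arises twice: once when the second
derivative hits [F2] in [F2 *: lie X1 g1], and once when it hits [g1] in
[X2(F2) *: g1]. *)
Lemma ulsubmx_lie_lie_doubly_warped c p : dom c p ->
  ulsubmx (lie X (lie X g) c p)
  = F2 p.2 *: lie X1 (lie X1 g1) c.1 p.1
    + (2 * vf_act X2 F2 p.2) *: lie X1 g1 c.1 p.1
    + vf_act X2 (vf_act X2 F2) p.2 *: g1 c.1 p.1.
Proof.
have sg := metric_smooth g1; have s0 : smooth_fun (cst 0 : M2 -> R).
  by move=> ?; exact: smooth_in_cst.
have lieE q : dom c q -> ulsubmx (lie X g c q)
    = F2 q.2 *: lie X1 g1 c.1 q.1 + vf_act X2 F2 q.2 *: g1 c.1 q.1.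
  move=> cq; rewrite (lie_ulsubmx (A := g1) (b := cst 0) (B := g1) cq sF2 s0
    (sg _) (sg _)).
    by rewrite vf_act_cst !scale0r !addr0.
  by move=> r _; rewrite scale0r addr0 doubly_warped_block block_mxKul.
move=> cp; rewrite (lie_ulsubmx (A := lie X1 g1) (B := g1) cp sF2
  (smooth_vf_act X2 sF2) (smooth_lie X1 (sg _)) (sg _) lieE).
by rewrite mulrDl !mul1r scalerDl !addrA.
Qed.

Lemma drsubmx_lie_lie_doubly_warped c p : dom c p ->
  drsubmx (lie X (lie X g) c p)
  = F1 p.1 *: lie X2 (lie X2 g2) c.2 p.2
    + (2 * vf_act X1 F1 p.1) *: lie X2 g2 c.2 p.2
    + vf_act X1 (vf_act X1 F1) p.1 *: g2 c.2 p.2.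
Proof.
have sg := metric_smooth g2; have s0 : smooth_fun (cst 0 : M1 -> R).
  by move=> ?; exact: smooth_in_cst.
have lieE q : dom c q -> drsubmx (lie X g c q)
    = F1 q.1 *: lie X2 g2 c.2 q.2 + vf_act X1 F1 q.1 *: g2 c.2 q.2.
  move=> cq; rewrite (lie_drsubmx (A := g2) (b := cst 0) (B := g2) cq sF1 s0
    (sg _) (sg _)).
    by rewrite vf_act_cst !scale0r !addr0.
  by move=> r _; rewrite scale0r addr0 doubly_warped_block block_mxKdr.
move=> cp; rewrite (lie_drsubmx (A := lie X2 g2) (B := g2) cp sF1
  (smooth_vf_act X1 sF1) (smooth_lie X2 (sg _)) (sg _) lieE).
by rewrite mulrDl !mul1r scalerDl !addrA.
Qed.

End doubly_warped_lie.
End product_lie.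

(** * The soliton equation *)

(** [F *: x = F *: y] is equivalent to [x = y], and [F] times the soliton
equation contains [F *: LL], which the hypothesis replaces by terms in [L] and
[G]. *)
Lemma soliton_equationE (K : fieldType) (V : lmodType K) (G L LL : V)
    (F F' F'' lambda m : K) : F != 0 -> lambda * F != 2 * F' ->
  F *: LL + (2 * F') *: L + F'' *: G = 0 ->
  LL + lambda *: L = m *: G
  <-> L = ((m * F + F'') / (lambda * F - 2 * F')) *: G.
Proof.
move=> F0; rewrite -subr_eq0; set D := lambda * F - 2 * F' => D0 E.
have FLL : F *: LL = - ((2 * F') *: L) - F'' *: G.
  by apply/eqP; rewrite -subr_eq0 opprD !opprK addrA E.
have key : F *: (LL + lambda *: L - m *: G) = D *: L - (m * F + F'') *: G.
  rewrite scalerBr scalerDr FLL !scalerA scalerBl scalerDl opprD.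
  rewrite ![F * _]mulrC [- _ - _ + _]addrAC [- _ + _]addrC -!addrA.
  exact: addrCA.
split=> [S|S]; last first.
  apply/subr0_eq/(scalerI F0).
  by rewrite scaler0 key S scalerA mulrC divfK// subrr.
have DL : D *: L = (m * F + F'') *: G.
  by apply/subr0_eq; rewrite -key S subrr scaler0.
by rewrite mulrC -scalerA -DL scalerA mulVf// scale1r.
Qed.

Theorem proposition4p3 (R : realType) (n1 n2 : nat)
  (M1 : manifold R n1) (M2 : manifold R n2)
  (g1 : riemannian_metric M1) (g2 : riemannian_metric M2)
  (f1 : warping_function M1) (f2 : warping_function M2)
  (zeta1 : vector_field M1) (zeta2 : vector_field M2)
  (h2K : two_killing (doubly_warped g1 g2 f1 f2)
           (vf_add (lift_fst zeta1) (lift_snd zeta2))) :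
  let F1 : M1 -> R := fun p => f1 p ^+ 2 in
  let F2 : M2 -> R := fun p => f2 p ^+ 2 in
  let r1 : M1 -> R := scalar_curvature g1 in
  let r2 : M2 -> R := scalar_curvature g2 in
  ((exists lambda mu : R,
      (forall p2 : M2, lambda * F2 p2 != 2 * vf_act zeta2 F2 p2) /\
      hyperbolic_yamabe_soliton g1 zeta1 lambda mu)
   <->
   (exists lambda mu : R,
      (forall p2 : M2, lambda * F2 p2 != 2 * vf_act zeta2 F2 p2) /\
      (forall (p1 : M1) (p2 : M2) (c : chart M1), dom c p1 ->
         lie zeta1 g1 c p1
         = (((mu - r1 p1) * F2 p2 + vf_act zeta2 (vf_act zeta2 F2) p2)
            / (lambda * F2 p2 - 2 * vf_act zeta2 F2 p2)) *: g1 c p1)))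
  /\
  ((exists lambda mu : R,
      (forall p1 : M1, lambda * F1 p1 != 2 * vf_act zeta1 F1 p1) /\
      hyperbolic_yamabe_soliton g2 zeta2 lambda mu)
   <->
   (exists lambda mu : R,
      (forall p1 : M1, lambda * F1 p1 != 2 * vf_act zeta1 F1 p1) /\
      (forall (p1 : M1) (p2 : M2) (c : chart M2), dom c p2 ->
         lie zeta2 g2 c p2
         = (((mu - r2 p2) * F1 p1 + vf_act zeta1 (vf_act zeta1 F1) p1)
            / (lambda * F1 p1 - 2 * vf_act zeta1 F1 p1)) *: g2 c p2))).
Proof.
move=> F1 F2 r1 r2.
have F1_neq0 p : F1 p != 0 by rewrite expf_neq0// gt_eqF// warping_pos.
have F2_neq0 p : F2 p != 0 by rewrite expf_neq0// gt_eqF// warping_pos.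
have [x1 _] := manifold_nonempty M1; have [x2 _] := manifold_nonempty M2.
have block1 p1 p2 c : dom c p1 ->
    F2 p2 *: lie zeta1 (lie zeta1 g1) c p1
    + (2 * vf_act zeta2 F2 p2) *: lie zeta1 g1 c p1
    + vf_act zeta2 (vf_act zeta2 F2) p2 *: g1 c p1 = 0.
  move=> cp1.
  have cp : @dom _ _ (prod_manifold M1 M2) (c, chart_at p2) (p1, p2).
    by split=> //; exact: chart_atP.
  rewrite -(ulsubmx_lie_lie_doubly_warped zeta1 zeta2 g1 g2 f1 f2 cp) h2K//.
  by apply/matrixP => i j; rewrite !mxE.
have block2 p1 p2 c : dom c p2 ->
    F1 p1 *: lie zeta2 (lie zeta2 g2) c p2
    + (2 * vf_act zeta1 F1 p1) *: lie zeta2 g2 c p2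
    + vf_act zeta1 (vf_act zeta1 F1) p1 *: g2 c p2 = 0.
  move=> cp2.
  have cp : @dom _ _ (prod_manifold M1 M2) (chart_at p1, c) (p1, p2).
    by split=> //; exact: chart_atP.
  rewrite -(drsubmx_lie_lie_doubly_warped zeta1 zeta2 g1 g2 f1 f2 cp) h2K//.
  by apply/matrixP => i j; rewrite !mxE.
split; split=> -[lambda [mu [ne S]]]; exists lambda, mu; split=> //.
- move=> p1 p2 c cp.
  exact/(soliton_equationE _ (F2_neq0 p2) (ne p2) (block1 p1 p2 c cp))/S.
- move=> c p1 cp.
  exact/(soliton_equationE _ (F2_neq0 x2) (ne x2) (block1 p1 x2 c cp))/S.
- move=> p1 p2 c cp.
  exact/(soliton_equationE _ (F1_neq0 p1) (ne p1) (block2 p1 p2 c cp))/S.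
- move=> c p2 cp.
  exact/(soliton_equationE _ (F1_neq0 x1) (ne x1) (block2 x1 p2 c cp))/S.
Qed.
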